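(* Let $\mathbb{X}=\{x_1,\dots,x_n\}$ be a finite alphabet of $n\ge1$ variables and $\mathbb{Y}$ another (potentially infinite) alphabet. For any integer $k\ge 1$, $$\frac1{n!}\int_{\mathbb{Y}}\Delta(\mathbb{X})^{2k}=\mathfrak{H}^k_n(\mathbb{Y}),$$ where $\Delta(\mathbb{X})=\prod_{i<j}(x_i-x_j)$.
   Context: $\Lambda^m(\mathbb{Y})$ is the $m$-th elementary symmetric function of $\mathbb{Y}$: $\sum_m\Lambda^m(\mathbb{Y})t^m=\prod_{y\in\mathbb{Y}}(1+yt)$, with $\Lambda^0=1$ and $\Lambda^m=0$ for $m<0$. $\int_{\mathbb{Y}}$ is the substitution $x^p\mapsto\Lambda^p(\mathbb{Y})$ for each $x\in\mathbb{X}$ and $p\in\mathbb{Z}$, i.e. the linear map from Laurent polynomials in $x_1,\dots,x_n$ to symmetric functions of $\mathbb{Y}$ with $\int_{\mathbb{Y}}x_1^{p_1}\cdots x_n^{p_n}=\Lambda^{p_1}(\mathbb{Y})\cdots\Lambda^{p_n}(\mathbb{Y})$ for all $(p_1,\dots,p_n)\in\mathbb{Z}^n$. For an array $M=(M_{i_1\cdots i_{2k}})_{0\le i_1,\dots,i_{2k}\le n-1}$, the hyperdeterminant is $\mathrm{Det}(M)=\frac1{n!}\sum_{\sigma_1,\dots,\sigma_{2k}}\mathrm{sign}(\sigma_1)\cdots\mathrm{sign}(\sigma_{2k})\prod_{i=0}^{n-1}M_{\sigma_1(i)\cdots\sigma_{2k}(i)}$, the sum being over all $2k$-tuples of permutations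 of $\{0,\dots,n-1\}$. Hankel hyperdeterminant: $\mathfrak{H}^k_n(\mathbb{Y})=\mathrm{Det}\left(\Lambda^{i_1+\cdots+i_{2k}}(\mathbb{Y})\right)_{0\le i_1,\dots,i_{2k}\le n-1}$. *)

(* Defs.v *)
From HB Require Import structures.
From mathcomp Require Import all_boot all_order all_algebra all_fingroup.
From mathcomp Require Import finmap boolp.
From mathcomp Require Import monalg.

Set Implicit Arguments.
Unset Strict Implicit.
Unset Printing Implicit Defensive.

Import GRing.Theory Num.Theory.

Local Open Scope fset_scope.
Local Open Scope ring_scope.

(* {malg _[_]} carries a ring structure only over monoids without nontrivial *)
(* units, so the group algebra of Z^n needs its own.  The coefficient of     *)
(* x^p in g is g@_p and the monomial x^p is << p >>.                         *)
Definition laurent (K : comNzRingType) (n : nat) : Type :=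
  {malg K[{ffun 'I_n -> int}]}.

Section LaurentRing.
Context {K : comNzRingType} {n : nat}.

Local Notation expo := {ffun 'I_n -> int}.
Implicit Types (g : laurent K n) (p : expo).

HB.instance Definition _ := GRing.Lmodule.on (laurent K n).

Definition laurent_one : laurent K n := << (0 : expo) >>.

Definition laurent_mul g1 g2 : laurent K n :=
  \sum_(p <- msupp g1) \sum_(q <- msupp g2) << g1@_p * g2@_q *g p + q >>.

Lemma laurent_mulw (d1 d2 : {fset expo}) g1 g2 :
  msupp g1 `<=` d1 -> msupp g2 `<=` d2 ->
  laurent_mul g1 g2 =
  \sum_(p <- d1) \sum_(q <- d2) << g1@_p * g2@_q *g p + q >>.
Proof.
move=> le1 le2; rewrite /laurent_mul (big_fset_incl _ le1) /=.
  apply/eq_bigr=> p _; apply/big_fset_incl => // q _ /mcoeff_outdom ->.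
  by rewrite mulr0 monalgU0.
move=> p _ /mcoeff_outdom g1p.
by rewrite big1 // => q _; rewrite g1p mul0r monalgU0.
Qed.

Lemma laurent_mulC : commutative laurent_mul.
Proof.
move=> g1 g2; rewrite /laurent_mul exchange_big /=.
by apply/eq_bigr=> p _; apply/eq_bigr=> q _; rewrite mulrC addrC.
Qed.

Lemma laurent_mulUU c1 c2 p1 p2 :
  laurent_mul << c1 *g p1 >> << c2 *g p2 >> = << c1 * c2 *g p1 + p2 >>.
Proof.
by rewrite (laurent_mulw msuppU_le msuppU_le) !big_seq_fset1 !mcoeffUU.
Qed.

Lemma laurent_mulDl : left_distributive laurent_mul +%R.
Proof.
move=> g1 g2 g.
rewrite (laurent_mulw (msuppD_le g1 g2) (fsubset_refl _)).
rewrite (laurent_mulw (fsubsetUl (msupp g1) (msupp g2)) (fsubset_refl _)).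
rewrite (laurent_mulw (fsubsetUr (msupp g1) (msupp g2)) (fsubset_refl _)).
rewrite -big_split /=; apply/eq_bigr=> p _.
rewrite -big_split /=; apply/eq_bigr=> q _.
by rewrite mcoeffD mulrDl monalgUD.
Qed.

Lemma laurent_mulDr : right_distributive laurent_mul +%R.
Proof.
by move=> g g1 g2; rewrite laurent_mulC laurent_mulDl !(laurent_mulC g).
Qed.

Lemma laurent_mul0r : left_zero 0 laurent_mul.
Proof. by move=> g; rewrite /laurent_mul msupp0 big_seq_fset0. Qed.

Lemma laurent_mulr0 : right_zero 0 laurent_mul.
Proof. by move=> g; rewrite laurent_mulC laurent_mul0r. Qed.

Lemma laurent_mul_suml (I : Type) (r : seq I) (F : I -> laurent K n) g :
  laurent_mul (\sum_(i <- r) F i) g = \sum_(i <- r) laurent_mul (F i) g.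
Proof.
exact: (big_morph (laurent_mul^~ g) (fun _ _ => laurent_mulDl _ _ _)
          (laurent_mul0r g)).
Qed.

Lemma laurent_mul_sumr (I : Type) (r : seq I) (F : I -> laurent K n) g :
  laurent_mul g (\sum_(i <- r) F i) = \sum_(i <- r) laurent_mul g (F i).
Proof.
exact: (big_morph (laurent_mul g) (laurent_mulDr g) (laurent_mulr0 g)).
Qed.

Lemma laurent_mulA : associative laurent_mul.
Proof.
move=> g1 g2 g3; rewrite (monalgE g1) [LHS]laurent_mul_suml.
rewrite [X in _ = laurent_mul X _]laurent_mul_suml [RHS]laurent_mul_suml.
apply: eq_bigr => p _; rewrite (monalgE g2).
rewrite [X in laurent_mul _ X = _]laurent_mul_suml [LHS]laurent_mul_sumr.
rewrite [X in _ = laurent_mul X _]laurent_mul_sumr [RHS]laurent_mul_suml.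
apply: eq_bigr => q _; rewrite (monalgE g3).
rewrite [X in laurent_mul _ X = _]laurent_mul_sumr [LHS]laurent_mul_sumr.
rewrite [RHS]laurent_mul_sumr; apply: eq_bigr => r _.
by rewrite !laurent_mulUU mulrA addrA.
Qed.

Lemma laurent_mul1r : left_id laurent_one laurent_mul.
Proof.
move=> g; rewrite (monalgE g) laurent_mul_sumr.
by apply: eq_bigr => p _; rewrite laurent_mulUU mul1r add0r.
Qed.

Lemma laurent_one_neq0 : laurent_one != 0.
Proof. by rewrite /laurent_one monalgU_eq0 oner_eq0. Qed.

HB.instance Definition _ := GRing.Zmodule_isComNzRing.Build (laurent K n)
  laurent_mulA laurent_mulC laurent_mul1r laurent_mulDl laurent_one_neq0.

Lemma laurent_scaleAl (c : K) g1 g2 : c *: (g1 * g2) = (c *: g1) * g2.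
Proof.
have scaleU a p : c *: (<< a *g p >> : laurent K n) = << c * a *g p >>.
  by apply/malgP => q; rewrite mcoeffZ !mcoeffU mulrnAr.
rewrite [g1](monalgE g1) [g2](monalgE g2) /GRing.mul /=.
rewrite [X in c *: X]laurent_mul_suml !scaler_sumr [RHS]laurent_mul_suml.
apply: eq_bigr => p _; rewrite [X in c *: X]laurent_mul_sumr scaler_sumr.
rewrite [RHS]laurent_mul_sumr; apply: eq_bigr => q _.
by rewrite !scaleU !laurent_mulUU scaleU mulrA.
Qed.

HB.instance Definition _ :=
  GRing.Lmodule_isLalgebra.Build K (laurent K n) laurent_scaleAl.
HB.instance Definition _ := GRing.Lalgebra_isComAlgebra.Build K (laurent K n).

End LaurentRing.

(* Formal power series in the possibly infinitely many letters of Y: the     *)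
(* coefficient of the monomial u in f is f u.                                *)
Definition pseries (K : Type) (Y : choiceType) : Type := {cmonom Y} -> K.

Section Divisors.
Context {Y : choiceType}.
Implicit Types (d u : {cmonom Y}).

Definition submonomial u (e : {ffun finsupp u -> 'I_(mdeg u).+1}) :
  {cmonom Y} := [cmonom nat_of_ord (e i) | i : finsupp u]%M.

Definition mdivs u : {fset {cmonom Y}} :=
  [fset d in [seq submonomial e | e : {ffun finsupp u -> 'I_(mdeg u).+1}]
     | mmul d (divcm u d) == u].

Lemma mem_mdivs d u : (d \in mdivs u) = (mmul d (divcm u d) == u).
Proof.
rewrite !inE andb_idl // => /eqP du.
have le_du i : (d i <= u i)%N by rewrite -du cmM leq_addr.
have le_deg i : (u i <= mdeg u)%N.
  by case: mdomP => // iu; rewrite mdegE (big_fsetD1 i) //= leq_addr.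
apply/mapP.
exists [ffun i : finsupp u => inord (d (val i)) : 'I_(mdeg u).+1].
  by rewrite mem_enum.
apply/eqP/cmP => i; rewrite cmE fsfun_ffun; case: insubP => /= [j ju vj|].
  by rewrite ffunE inordK ?vj // ltnS (leq_trans (le_du _)).
by rewrite -cmE_eq0 => /eqP ui; apply/eqP; move: (le_du i); rewrite ui leqn0.
Qed.

Lemma divcmK d u : divcm (mmul d u) d = u.
Proof. by apply/eqP/cmP => i; rewrite divcmE cmM addKn. Qed.

Lemma mdivsP d u : reflect (exists e, u = mmul d e) (d \in mdivs u).
Proof.
rewrite mem_mdivs; apply: (iffP eqP) => [<-|[e ->]].
  by exists (divcm u d); rewrite ?divcmK.
by rewrite divcmK.
Qed.

Lemma mdivs_trans d u v : d \in mdivs u -> u \in mdivs v -> d \in mdivs v.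
Proof.
move=> /mdivsP[e ->] /mdivsP[e' ->]; apply/mdivsP.
by exists (mmul e e'); rewrite mulmA.
Qed.

End Divisors.

Section SeriesRing.
Context {K : comNzRingType} {Y : choiceType}.
Implicit Types (f g h : pseries K Y) (u d : {cmonom Y}).

HB.instance Definition _ := gen_eqMixin (pseries K Y).
HB.instance Definition _ := gen_choiceMixin (pseries K Y).

Definition pseries_zero : pseries K Y := fun=> 0.
Definition pseries_opp f : pseries K Y := fun u => - f u.
Definition pseries_add f g : pseries K Y := fun u => f u + g u.

Lemma pseries_addA : associative pseries_add.
Proof. by move=> f g h; apply/funext => u; apply: addrA. Qed.

Lemma pseries_addC : commutative pseries_add.
Proof. by move=> f g; apply/funext => u; apply: addrC. Qed.

Lemma pseries_add0 : left_id pseries_zero pseries_add.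
Proof. by move=> f; apply/funext => u; apply: add0r. Qed.

Lemma pseries_addN : left_inverse pseries_zero pseries_opp pseries_add.
Proof. by move=> f; apply/funext => u; apply: addNr. Qed.

HB.instance Definition _ := GRing.isZmodule.Build (pseries K Y)
  pseries_addA pseries_addC pseries_add0 pseries_addN.

Definition pseries_one : pseries K Y := fun u => (u == mone)%:R.

Definition pseries_mul f g : pseries K Y :=
  fun u => \sum_(d <- mdivs u) f d * g (divcm u d).

(* On a given monomial, the product only depends on polynomial truncations. *)
Definition pstrunc (E : {fset {cmonom Y}}) f : {malg K[{cmonom Y}]} :=
  \sum_(d <- E) << f d *g d >>.

Lemma mcoeff_trunc E f d : d \in E -> (pstrunc E f)@_d = f d.
Proof.
move=> dE; rewrite /pstrunc (big_morph (mcoeff d) (mcoeffD d) (mcoeff0 d)).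
rewrite (big_fsetD1 d dE) big1_fset => [|e].
  by rewrite /= addr0; apply: mcoeffUU.
rewrite in_fsetD1 => /andP[ne _] _.
by apply: etrans (mcoeffU _ _ _) _; rewrite (negbTE ne).
Qed.

Lemma pseries_mul_malg (F G : {malg K[{cmonom Y}]}) f g u :
  {in mdivs u, forall d, F@_d = f d} -> {in mdivs u, forall d, G@_d = g d} ->
  pseries_mul f g u = (F * G)@_u.
Proof.
move=> Ff Gg; pose E := msupp F `|` msupp G `|` mdivs u.
have sF : msupp F `<=` E by rewrite /E -fsetUA fsubsetUl.
have sG : msupp G `<=` E by rewrite /E fsubsetU // fsubsetUr.
have sD : mdivs u `<=` E by rewrite /E fsubsetUr.
rewrite (mcoeffMlw _ sF sG) -(big_fset_incl _ sD) /=; last first.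
  move=> d _ du; rewrite big1 // => e _; case: eqP => // ude.
  by case/negP: du; apply/mdivsP; exists e.
rewrite /pseries_mul big_seq [RHS]big_seq; apply: eq_bigr => d du.
have eu : divcm u d \in mdivs u.
  apply/mdivsP; exists d; rewrite mulmC; apply/esym/eqP.
  by rewrite -mem_mdivs.
rewrite (big_fsetD1 (divcm u d)) ?(fsubsetP sD) //= -mem_mdivs du Ff // Gg //.
rewrite big_seq big1 ?addr0 // => e; rewrite in_fsetD1 => /andP[ne _].
by case: eqP => // ude; rewrite -ude divcmK eqxx in ne.
Qed.

Lemma pseries_mul_trunc f g u v : u \in mdivs v ->
  (pstrunc (mdivs v) f * pstrunc (mdivs v) g)@_u = pseries_mul f g u.
Proof.
move=> uv; set D := mdivs v.
rewrite (@pseries_mul_malg (pstrunc D f) (pstrunc D g)) // => d du;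
  rewrite mcoeff_trunc //; exact: mdivs_trans uv.
Qed.

Lemma mdivs_refl u : u \in mdivs u.
Proof. by apply/mdivsP; exists mone; rewrite mulm1. Qed.

Lemma pseries_mulA : associative pseries_mul.
Proof.
move=> f g h; apply/funext => u; set D := mdivs u.
rewrite (@pseries_mul_malg (pstrunc D f) (pstrunc D g * pstrunc D h)).
- rewrite mulrA; apply/esym/pseries_mul_malg => d dD.
  + by rewrite pseries_mul_trunc.
  + by rewrite mcoeff_trunc.
- by move=> d dD; rewrite mcoeff_trunc.
- by move=> d dD; rewrite pseries_mul_trunc.
Qed.

Lemma pseries_mulC : commutative pseries_mul.
Proof.
move=> f g; apply/funext => u.
apply: etrans (esym (pseries_mul_trunc f g (mdivs_refl u))) _.
by rewrite mulrC; apply: pseries_mul_trunc (mdivs_refl u).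
Qed.

Lemma pseries_mul1 : left_id pseries_one pseries_mul.
Proof.
move=> f; apply/funext => u.
rewrite (@pseries_mul_malg 1 (pstrunc (mdivs u) f)).
- by rewrite mul1r mcoeff_trunc ?mdivs_refl.
- by move=> d _; apply: mcoeff1.
- by move=> d dD; apply: mcoeff_trunc.
Qed.

Lemma pseries_mulDl : left_distributive pseries_mul +%R.
Proof.
move=> f g h; apply/funext => u; apply: etrans (big_split _ _ _ _ _).
by apply: eq_bigr => d _; apply: mulrDl.
Qed.

Lemma pseries_one_neq0 : pseries_one != 0.
Proof.
apply/eqP => /(congr1 (fun f => f mone)) /eqP.
by rewrite /pseries_one eqxx oner_eq0.
Qed.

HB.instance Definition _ := GRing.Zmodule_isComNzRing.Build (pseries K Y)
  pseries_mulA pseries_mulC pseries_mul1 pseries_mulDl pseries_one_neq0.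

Definition pseries_scale (c : K) f : pseries K Y := fun u => c * f u.

Lemma pseries_scaleA a b f :
  pseries_scale a (pseries_scale b f) = pseries_scale (a * b) f.
Proof. by apply/funext => u; apply: mulrA. Qed.

Lemma pseries_scale1 : left_id 1 pseries_scale.
Proof. by move=> f; apply/funext => u; apply: mul1r. Qed.

Lemma pseries_scaleDr : right_distributive pseries_scale +%R.
Proof. by move=> c f g; apply/funext => u; apply: mulrDr. Qed.

Lemma pseries_scaleDl f : {morph pseries_scale^~ f : a b / a + b}.
Proof. by move=> a b; apply/funext => u; apply: mulrDl. Qed.

HB.instance Definition _ := GRing.Zmodule_isLmodule.Build K (pseries K Y)
  pseries_scaleA pseries_scale1 pseries_scaleDr pseries_scaleDl.

Lemma pseries_scaleAl (c : K) f g : c *: (f * g) = (c *: f) * g.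
Proof.
apply/funext => u; rewrite [LHS]mulr_sumr; apply: eq_bigr => d _.
exact: mulrA.
Qed.

HB.instance Definition _ :=
  GRing.Lmodule_isLalgebra.Build K (pseries K Y) pseries_scaleAl.
HB.instance Definition _ := GRing.Lalgebra_isComAlgebra.Build K (pseries K Y).

Lemma pseries1E u : (1 : pseries K Y) u = (u == mone)%:R. Proof. by []. Qed.

Lemma pseriesDE f g u : (f + g) u = f u + g u. Proof. by []. Qed.

Lemma pseriesME f g u : (f * g) u = \sum_(d <- mdivs u) f d * g (divcm u d).
Proof. by []. Qed.

Lemma pseriesZE (c : K) f u : (c *: f) u = c * f u. Proof. by []. Qed.

End SeriesRing.

Section Elementary.
Context (K : comNzRingType) (Y : choiceType).

Definition letter (y : Y) : pseries K Y := fun u => (u == ucm y)%:R.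

Definition squarefree (u : {cmonom Y}) : bool :=
  all (fun y => u y == 1%N) (finsupp u).

Definition elementary (m : nat) : pseries K Y :=
  fun u => (squarefree u && (mdeg u == m))%:R.

Definition Lambda (m : int) : pseries K Y :=
  if m is Posz p then elementary p else 0.

Lemma Lambda0 : Lambda 0 = 1.
Proof.
apply/funext => u; change (elementary 0 u = (u == mone)%:R).
rewrite /elementary mdeg_eq0 andb_idl // => /eqP ->.
by rewrite /squarefree mdom1.
Qed.

Lemma letterM y (f : pseries K Y) u :
  (letter y * f) u = if y \in finsupp u then f (divcm u (ucm y)) else 0.
Proof.
rewrite pseriesME; have [yu|yu] := boolP (y \in _).
  have yD : ucm y \in mdivs u.
    rewrite mem_mdivs; apply/cmP => i; rewrite cmM divcmE cmU subnKC //.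
    by case: eqP => //= <-; rewrite lt0n cmE_neq0.
  rewrite (big_fsetD1 (ucm y)) //= {1}/letter eqxx mul1r big_seq big1 ?addr0 //.
  by move=> d; rewrite in_fsetD1 /letter => /andP[/negbTE -> _]; rewrite mul0r.
rewrite big_seq big1 // => d /mdivsP[e ue]; rewrite /letter.
case: eqP => [dy|_]; last by rewrite mul0r.
by case/negP: yu; rewrite ue dy mdomD mdomU in_fsetU in_fset1 eqxx.
Qed.

Lemma squarefree_div (s : seq Y) y (u : {cmonom Y}) :
  y \notin s -> y \in finsupp u ->
  {subset finsupp (divcm u (ucm y)) <= s} /\ squarefree (divcm u (ucm y)) <->
  {subset finsupp u <= y :: s} /\ squarefree u.
Proof.
rewrite -cmE_neq0 => ys uy.
have vE i : i != y -> divcm u (ucm y) i = u i.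
  by move=> iy; rewrite divcmE cmU eq_sym (negbTE iy) subn0.
have vy : divcm u (ucm y) y = (u y).-1 by rewrite divcmE cmUU subn1.
split=> -[sub /allP sq].
  have uy1 : u y == 1%N.
    have : y \notin finsupp (divcm u (ucm y)) by apply: contra ys; apply: sub.
    by rewrite -cmE_eq0 vy; case: (u y) uy => [//|[]].
  split.
    move=> i; rewrite inE; case: eqVneq => //= iy.
    by rewrite -cmE_neq0 -(vE _ iy) cmE_neq0; apply: sub.
  apply/allP => i; case: (eqVneq i y) => [-> //|iy].
  by rewrite -cmE_neq0 -(vE _ iy) cmE_neq0; apply: sq.
have uy1 : u y = 1%N by apply/eqP/sq; rewrite -cmE_neq0.
have vy0 : y \notin finsupp (divcm u (ucm y)) by rewrite -cmE_eq0 vy uy1.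
split.
  move=> i iv.
  have iy : i != y by apply: contraNneq vy0 => iy; move: iv; rewrite iy.
  have : i \in finsupp u by rewrite -cmE_neq0 -(vE _ iy) cmE_neq0.
  by move/sub; rewrite inE (negbTE iy).
apply/allP => i iv.
have iy : i != y by apply: contraNneq vy0 => iy; move: iv; rewrite iy.
by rewrite vE //; apply: sq; rewrite -cmE_neq0 -(vE _ iy) cmE_neq0.
Qed.

Lemma coef_prod_letters_seq (s : seq Y) (m : nat) (u : {cmonom Y}) : uniq s ->
  (\prod_(y <- s) (1 + letter y *: 'X) : {poly pseries K Y})`_m u =
  [&& all [in s] (finsupp u), squarefree u & mdeg u == m]%:R.
Proof.
elim: s m u => [|y s IHs] m u; last move=> /andP[ys us].
  move=> _; rewrite big_nil coef1.
  have -> : all [in [::]] (finsupp u) = (u == mone).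
    rewrite -mdeg_eq0.
    apply/allP/idP => [sub|/eqP/mdeg_eq0I -> i]; last by rewrite mdom1.
    rewrite mdeg_eq0; apply/cmP => i; rewrite cm1; apply/eqP.
    by rewrite cmE_eq0; apply/negP => /sub.
  case: (eqVneq u mone) => [->|u1] /=.
    rewrite mdeg1 /squarefree mdom1 /= eq_sym; case: (0%N == m) => //.
    by rewrite mulr1n pseries1E eqxx.
  case: (m == 0%N) => //.
  by rewrite mulr1n pseries1E (negbTE u1).
rewrite big_cons mulrDl mul1r coefD pseriesDE IHs // -scalerAl coefZ coefXM.
rewrite letterM; have [yu|yu] := boolP (y \in finsupp u); last first.
  rewrite addr0; congr (_ && _)%:R; apply/allP/allP => sub i iu.
    by rewrite inE orbC sub.
  by have := sub i iu; rewrite inE; case: eqP => // iy; rewrite -iy iu in yu.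
have -> : all [in s] (finsupp u) = false.
  by apply/negbTE/allPn; exists y.
rewrite add0r; case: m => [|m] /=.
  by rewrite mdeg_eq0; case: eqVneq yu => [->|]; rewrite ?mdom1 // !andbF.
have -> : (mdeg u == m.+1) = (mdeg (divcm u (ucm y)) == m).
  have {1}-> : u = mmul (ucm y) (divcm u (ucm y)).
    apply/eqP/cmP => i; rewrite cmM divcmE cmU subnKC //.
    by case: eqP => //= <-; rewrite lt0n cmE_neq0.
  by rewrite mdegM mdegU.
rewrite IHs // !andbA; congr (_ && _)%:R.
have [to from] := squarefree_div ys yu.
by apply/andP/andP => -[/allP sub sq]; [case: to|case: from];
  split=> //; apply/allP.
Qed.

(* Lambda^m(Y) is the coefficient of t^m in prod_y (1 + y t): a finite       *)
(* subproduct has the right coefficient at each monomial in its letters, and *)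
(* the coefficient 0 elsewhere.                                              *)
Lemma coef_prod_letters (A : {fset Y}) (m : nat) (u : {cmonom Y}) :
  (\prod_(y <- A) (1 + letter y *: 'X) : {poly pseries K Y})`_m u =
  if finsupp u `<=` A then Lambda m u else 0.
Proof.
rewrite coef_prod_letters_seq ?fset_uniq //.
have -> : all [in enum_fset A] (finsupp u) = (finsupp u `<=` A).
  by apply/allP/fsubsetP.
by case: (_ `<=` _).
Qed.

End Elementary.

Arguments letter K {Y} y.
Arguments elementary K Y m : clear implicits.
Arguments Lambda K Y m : clear implicits.

Section Integral.
Context {K : comNzRingType} (Y : choiceType) {n : nat}.
Implicit Types (g : laurent K n) (p : {ffun 'I_n -> int}).

(* The map written int_Y, i.e. x^p |-> prod_i Lambda^(p_i)(Y) on monomials,  *)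
(* extended linearly (umbralE, umbral_is_linear).                            *)
Definition umbral g : pseries K Y :=
  \sum_(p <- msupp g) g@_p *: \prod_(i < n) Lambda K Y (p i).

Lemma umbralw (d : {fset {ffun 'I_n -> int}}) g : msupp g `<=` d ->
  umbral g = \sum_(p <- d) g@_p *: \prod_(i < n) Lambda K Y (p i).
Proof.
move=> le; rewrite /umbral (big_fset_incl _ le) // => p _ /mcoeff_outdom ->.
by rewrite scale0r.
Qed.

Lemma umbralE p : umbral << p >> = \prod_(i < n) Lambda K Y (p i).
Proof. by rewrite (umbralw msuppU_le) big_seq_fset1 mcoeffUU scale1r. Qed.

Lemma umbral_is_linear : linear umbral.
Proof.
move=> c g1 g2; set d := msupp g1 `|` msupp g2.
have s1 : msupp g1 `<=` d by apply: fsubsetUl.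
have s2 : msupp g2 `<=` d by apply: fsubsetUr.
rewrite (umbralw s1) (umbralw s2) (@umbralw d); last first.
  apply: (fsubset_trans (msuppD_le _ _)); rewrite fsubUset s2 andbT.
  exact: fsubset_trans (msuppZ_le _ _) s1.
rewrite scaler_sumr -big_split /=; apply: eq_bigr => p _.
by rewrite mcoeffD mcoeffZ scalerDl scalerA.
Qed.

HB.instance Definition _ :=
  GRing.isLinear.Build K (laurent K n) (pseries K Y) *:%R umbral
    umbral_is_linear.

End Integral.

Arguments umbral {K} Y {n} g.

Definition xvar (K : comNzRingType) (n : nat) (i : 'I_n) : laurent K n :=
  << [ffun j => Posz (j == i)] >>.

Definition vdm_prod (K : comNzRingType) (n : nat) : laurent K n :=
  \prod_(i < n) \prod_(j < n | (i < j)%N) (xvar K i - xvar K j).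

Definition hyperdet (K : fieldType) (A : comAlgType K) (r n : nat)
    (M : {ffun 'I_r -> 'I_n} -> A) : A :=
  (n`!%:R : K)^-1 *:
    \sum_(s : {ffun 'I_r -> 'S_n})
      (\prod_(j < r) (-1) ^+ s j) * \prod_(i < n) M [ffun j => s j i].

Definition hankel_hyperdet (K : fieldType) (Y : choiceType) (n k : nat) :
    pseries K Y :=
  hyperdet (fun i : {ffun 'I_(2 * k) -> 'I_n} =>
              Lambda K Y (Posz (\sum_(j < 2 * k) i j)%N)).

Arguments hankel_hyperdet K Y n k : clear implicits.

(* Main.v *)
Require Import Defs.
From mathcomp Require Import all_boot all_order all_algebra.
From mathcomp Require Import all_fingroup.
From mathcomp Require Import monalg.

Import GRing.Theory.
Local Open Scope ring_scope.

(** Up to a sign, [vdm_prod] is the determinant of the Vandermonde matrix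
    [(x_i ^+ j)], and the even power [2 * k] removes the sign.  Expanding each of
    the [2 * k] determinants by the Leibniz formula and distributing the product
    over the sums gives a signed sum over [2 * k]-tuples of permutations
    ([vdm_prod_exp]); in the term of [s], the variable [x_i] collects the
    exponent [\sum_j s j i].  Since this term is, up to sign, a single monomial,
    the integral over [Y] turns it into [\prod_i Lambda (\sum_j s j i)], which is
    exactly the term of [s] in the hyperdeterminant of the Hankel array. *)

Section Monomials.
Variables (K : comNzRingType) (n : nat).
Implicit Types (p q : {ffun 'I_n -> int}) (i : 'I_n).

Definition monomial p : laurent K n := << p >>.

Lemma monomialD p q : monomial (p + q) = monomial p * monomial q.
Proof. by rewrite [RHS]laurent_mulUU mulr1. Qed.

Lemma monomial_sum (I : Type) (r : seq I) (F : I -> {ffun 'I_n -> int}) :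
  monomial (\sum_(i <- r) F i) = \prod_(i <- r) monomial (F i).
Proof. exact: (big_morph monomial monomialD). Qed.

Lemma xvarX i m : xvar K i ^+ m = monomial ([ffun j => Posz (j == i)] *+ m).
Proof.
elim: m => [//|m IHm].
by rewrite exprS mulrS IHm monomialD.
Qed.

Lemma prod_xvarX (e : 'I_n -> nat) :
  \prod_(i < n) xvar K i ^+ e i = monomial [ffun i => Posz (e i)].
Proof.
under eq_bigr do rewrite xvarX.
rewrite -monomial_sum; congr monomial; apply/ffunP => j.
rewrite sum_ffunE ffunE (bigD1 j) //= big1 => [|i ij].
  by rewrite addr0 ffunMnE ffunE eqxx natz.
by rewrite ffunMnE ffunE eq_sym (negbTE ij) mul0rn.
Qed.

End Monomials.

(** The sign relating the two products depends only on the number of pairs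
    [i < j], hence disappears in an even power. *)
Lemma vdm_prod_det (K : comNzRingType) (n k : nat) :
  vdm_prod K n ^+ (2 * k) =
  \det (\matrix_(i < n, j < n) xvar K i ^+ j) ^+ (2 * k).
Proof.
have -> : (\matrix_(i < n, j < n) xvar K i ^+ j) =
          (Vandermonde n (\row_i xvar K i))^T.
  by apply/matrixP => i j; rewrite !mxE.
rewrite det_tr det_Vandermonde !exprM; congr (_ ^+ k).
rewrite /vdm_prod -!prodrXl; apply: eq_bigr => i _.
rewrite -!prodrXl; apply: eq_bigr => j _.
by rewrite !mxE -sqrrN opprB.
Qed.

(** Each of the [2 * k] determinants contributes one permutation, so the sum runs
    over families of permutations; grouping the factors by variable rather than
    by determinant adds up the exponents of each [x_i]. *)
Lemma vdm_prod_exp (K : comNzRingType) (n k : nat) :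
  vdm_prod K n ^+ (2 * k) =
  \sum_(s : {ffun 'I_(2 * k) -> 'S_n})
    (\prod_(j < 2 * k) (-1) ^+ s j) *
    monomial K n [ffun i => Posz (\sum_(j < 2 * k) s j i)%N].
Proof.
rewrite vdm_prod_det -[X in _ ^+ X]card_ord -prodr_const.
rewrite bigA_distr_bigA /=; apply: eq_bigr => s _.
rewrite big_split /= -prod_xvarX exchange_big /=; congr (_ * _).
apply: eq_bigr => i _; rewrite -prodrXr.
by apply: eq_bigr => j _; rewrite mxE.
Qed.

Theorem proposition2p2 (K : fieldType) (charK0 : [pchar K] =i pred0)
    (Y : choiceType) (n k : nat) (n_ge1 : (1 <= n)%N) (k_ge1 : (1 <= k)%N) :
  (n`!%:R : K)^-1 *: umbral Y (vdm_prod K n ^+ (2 * k)) =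
  hankel_hyperdet K Y n k.
Proof.
rewrite vdm_prod_exp /hankel_hyperdet /hyperdet; congr (_ *: _).
rewrite raddf_sum; apply: eq_bigr => s _.
rewrite !prodrXr raddfMsign; congr (_ * _).
rewrite [LHS]umbralE; apply: eq_bigr => i _; rewrite ffunE.
by congr (Lambda _ _ (Posz _)); apply: eq_bigr => j _; rewrite ffunE.
Qed.
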